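(* For a forest with duplications $P$ on $\{1,\ldots,n\}$, $$\sum_{f\in\mathcal{A}^{\mathrm{weak}}(P)}t^{\nu(f)}\mathbf{x}^f=\frac{\prod_{\{J_1,J_2\}\in\Pi(P)}\bigl(1-t^2\mathbf{x}^{J_1}\mathbf{x}^{J_2}\bigr)}{\prod_{J\in\mathcal{J}_{\mathrm{conn}}(P)}\bigl(1-t\mathbf{x}^J\bigr)}.$$ Setting $t=1$ and $x_i=q$ for all $i$, this gives $$\sum_{f\in\mathcal{A}^{\mathrm{weak}}(P)}q^{|f|}=\frac{\prod_{\{J_1,J_2\}\in\Pi(P)}\bigl(1-q^{|J_1|+|J_2|}\bigr)}{\prod_{J\in\mathcal{J}_{\mathrm{conn}}(P)}\bigl(1-q^{|J|}\bigr)}.$$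
   Context: All posets are finite. $\mathcal{A}^{\mathrm{weak}}(P)$ is the set of weak $P$-partitions $f:\{1,\ldots,n\}\to\mathbb{N}$ ($f(i)\ge f(j)$ whenever $i<_Pj$); $\mathbf{x}^f=\prod_ix_i^{f(i)}$, $|f|=\sum_if(i)$, $\mathbf{x}^J=\prod_{j\in J}x_j$. $\nu(f)=\sum_{k\ge1}(\text{number of connected components of the Hasse diagram of }P\text{ restricted to }\{j:f(j)\ge k\})$. An order ideal is a downward-closed subset; a connected order ideal is a nonempty order ideal whose induced Hasse diagram is connected; $\mathcal{J}_{\mathrm{conn}}(P)$ is the set of these. Two connected order ideals intersect trivially if disjoint or nested, nontrivially otherwise; $\Pi(P)$ is the set of unordered pairs of connected order ideals intersecting nontrivially. Forests with duplications are the posets obtainable from one-element posets by iterating: (1) disjoint union; (2) hanging $P_2$ below $a\in P_1$: on $P_1\sqcup P_2$ add relations $p_2<b$ for all $p_2\in P_2$ and all $b\ge_{P_1}a$; (3) duplication of a hanger: $a$ is a hanger if $P_{<a}\ne\varnothing$ and every Hasse-diagram path from $P_{<a}$ to $P\setminus P_{\le a}$ passes through $a$; duplicating it forms $P\sqcup\{a'\}$ with the relations of $P$ plus $p<a'$ whenever $p<_Pa$ and $a'<p$ whenever $a<_Pp$. *)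

(* Defs.v *)
From HB Require Import structures.
From mathcomp Require Import all_boot all_order all_algebra.
From mathcomp Require Import mpoly.

Set Implicit Arguments.
Unset Strict Implicit.
Unset Printing Implicit Defensive.

Import GRing.Theory.

(* Posets given by a (reflexive) order relation [le] on a finite type *)
Section PosetDefs.
Variables (T : finType) (le : rel T).

Definition plt (x y : T) : bool := (x != y) && le x y.

Definition pcover (x y : T) : bool :=
  plt x y && [forall z, ~~ (plt x z && plt z y)].
Definition hasse (x y : T) : bool := pcover x y || pcover y x.

Definition hasse_in (S : {set T}) (u v : T) : bool :=
  [&& u \in S, v \in S & hasse u v].

Definition ncomp (S : {set T}) : nat :=
  #|[set [set y in S | connect (hasse_in S) x y] | x in S]|.

Definition order_ideal (S : {set T}) : bool :=
  [forall x, forall y, ((y \in S) && le x y) ==> (x \in S)].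

Definition conn_ideal (S : {set T}) : bool :=
  [&& S != set0, order_ideal S &
      [forall x in S, forall y in S, connect (hasse_in S) x y]].

Definition Jconn : {set {set T}} := [set S | conn_ideal S].

Definition nontriv (J1 J2 : {set T}) : bool :=
  [&& J1 :&: J2 != set0, ~~ (J1 \subset J2) & ~~ (J2 \subset J1)].

Definition PiP : {set {set {set T}}} :=
  [set Q : {set {set T}} | [&& #|Q| == 2, Q \subset Jconn &
      [forall J1 in Q, forall J2 in Q, (J1 != J2) ==> nontriv J1 J2]]].

Definition weakPP (f : T -> nat) : bool :=
  [forall i, forall j, plt i j ==> (f j <= f i)%N].

(* nu(f) = sum_{k >= 1} ncomp {j | f j >= k}; the terms with
   k > max f vanish (empty set), so the sum is truncated there *)
Definition nu (f : T -> nat) : nat :=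
  (\sum_(1 <= k < (\max_i f i).+1) ncomp [set j | (k <= f j)%N])%N.

Definition hanger (a : T) : Prop :=
  (exists x, plt x a) /\
  forall (x y : T) (p : seq T),
    plt x a -> ~~ le y a -> path hasse x p -> last x p = y -> a \in x :: p.

End PosetDefs.

Definition sum_rel (T1 T2 : finType) (r1 : rel T1) (r2 : rel T2)
  : rel (T1 + T2)%type :=
  fun u v => match u, v with
             | inl x, inl y => r1 x y
             | inr x, inr y => r2 x y
             | _, _ => false
             end.

Definition hang_rel (T1 T2 : finType) (r1 : rel T1) (r2 : rel T2) (a : T1)
  : rel (T1 + T2)%type :=
  fun u v => match u, v with
             | inl x, inl y => r1 x y
             | inr x, inr y => r2 x y
             | inr _, inl b => r1 a b
             | inl _, inr _ => false
             end.

(* duplicate a; the copy a' is None *)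
Definition dup_rel (T : finType) (r : rel T) (a : T) : rel (option T) :=
  fun u v => match u, v with
             | Some x, Some y => r x y
             | None, None => true
             | None, Some p => plt r a p
             | Some p, None => plt r p a
             end.

Inductive forest_dup : forall T : finType, rel T -> Prop :=
| FD_one (T : finType) : #|T| = 1 -> forest_dup (fun x y : T => x == y)
| FD_iso (T U : finType) (r : rel T) (s : rel U) (g : T -> U) :
    bijective g -> (forall x y, s (g x) (g y) = r x y) ->
    forest_dup r -> forest_dup s
| FD_union (T1 T2 : finType) (r1 : rel T1) (r2 : rel T2) :
    forest_dup r1 -> forest_dup r2 -> forest_dup (sum_rel r1 r2)
| FD_hang (T1 T2 : finType) (r1 : rel T1) (r2 : rel T2) (a : T1) :
    forest_dup r1 -> forest_dup r2 -> forest_dup (hang_rel r1 r2 a)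
| FD_dup (T : finType) (r : rel T) (a : T) :
    forest_dup r -> hanger r a -> forest_dup (dup_rel r a).

Local Open Scope ring_scope.

(* Cauchy product of two formal power series (coefficient functions) *)
Definition mulS (k : nat) (A B : 'X_{1..k} -> int) (m : 'X_{1..k}) : int :=
  \sum_(m1 : 'X_{1..k < (mdeg m).+1} | (bmnm m1 <= m)%MM)
     A (bmnm m1) * B (m - bmnm m1)%MM.

(* variables: x_1..x_n are indices widen i, t is index ord_max (= n) *)
Definition xpart (n : nat) (m : 'X_{1..n.+1}) : 'I_n -> nat :=
  fun i => m (widen_ord (leqnSn n) i).

(* sum_{f weak P-partition} t^nu(f) x^f, as a coefficient function *)
Definition genF (n : nat) (le : rel 'I_n) (m : 'X_{1..n.+1}) : int :=
  (weakPP le (xpart m) && (nu le (xpart m) == m ord_max))%:Z.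

Definition tvar (n : nat) : {mpoly int[n.+1]} := 'X_ord_max.
Definition xvar (n : nat) (i : 'I_n) : {mpoly int[n.+1]} :=
  'X_(widen_ord (leqnSn n) i).
Definition xJ (n : nat) (J : {set 'I_n}) : {mpoly int[n.+1]} :=
  \prod_(j in J) xvar j.

Definition DenTX (n : nat) (le : rel 'I_n) : {mpoly int[n.+1]} :=
  \prod_(J in Jconn le) (1 - tvar n * xJ J).
Definition NumTX (n : nat) (le : rel 'I_n) : {mpoly int[n.+1]} :=
  \prod_(Q in PiP le) (1 - tvar n ^+ 2 * \prod_(J in Q) xJ J).

(* specialization t = 1, x_i = q *)
Definition genQ (n : nat) (le : rel 'I_n) (d : nat) : nat :=
  #|[set f : {ffun 'I_n -> 'I_d.+1} |
       weakPP le (fun i => nat_of_ord (f i)) &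
       (\sum_i nat_of_ord (f i) == d)%N]|.

Definition DenQ (n : nat) (le : rel 'I_n) : {poly int} :=
  \prod_(J in Jconn le) (1 - 'X^#|J|).
Definition NumQ (n : nat) (le : rel 'I_n) : {poly int} :=
  \prod_(Q in PiP le) (1 - 'X^(\sum_(J in Q) #|J|)).

(* Main.v *)
Require Import Defs.
From HB Require Import structures.
From mathcomp Require Import all_boot all_order all_algebra.
From mathcomp Require Import mpoly.

(* Splitting each level set {f >= k} of a weak P-partition f into connected
   components writes f uniquely as a sum of indicators of connected order ideals
   that pairwise intersect trivially, and the number of summands is nu(f). Hence
   the series enumerates multisets of connected ideals whose support contains no
   pair of PiP. In a forest with duplications the pairs in PiP are disjoint:
   hanging and disjoint union create no new pair, while duplicating a hanger a
   creates a single one, formed by the two new ideals P_{<=a} and P_{<=a'}.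
   For disjoint forbidden pairs, inclusion-exclusion gives the product formula.
   Both identities are instances of one congruence, in an arbitrary commutative
   ring, between truncated sums modulo an ideal containing the large powers of
   the weights. *)

Set Implicit Arguments.
Unset Strict Implicit.
Unset Printing Implicit Defensive.

Import GRing.Theory.

(** * Connected order ideals *)

Definition poset (T : finType) (le : rel T) : Prop :=
  [/\ reflexive le, antisymmetric le & transitive le].

Lemma connect_ind (T : finType) (e : rel T) (P : T -> Prop) (x y : T) :
  (forall u v, P u -> e u v -> P v) -> P x -> connect e x y -> P y.
Proof.
move=> Pe Px /connectP[p + ->]; elim: p x Px => //= z p IHp x Px /andP[exz].
exact/IHp/Pe/exz.
Qed.

Section Components.
Variables (T : finType) (le : rel T).
Hypothesis le_poset : poset le.
Implicit Types (S J K : {set T}) (x y z : T).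

Let lexx x : le x x. Proof. by case: le_poset. Qed.
Let le_anti x y : le x y -> le y x -> x = y.
Proof. by case: le_poset => _ anti _ xy yx; apply: anti; rewrite xy. Qed.
Let le_trans y x z : le x y -> le y z -> le x z.
Proof. by case: le_poset => _ _; apply. Qed.

Lemma order_idealP S :
  reflect (forall x y, y \in S -> le x y -> x \in S) (order_ideal le S).
Proof.
apply: (iffP forallP) => [idS x y yS lexy|idS x].
  by have /forallP/(_ y)/implyP := idS x; rewrite yS lexy; apply.
by apply/forallP => y; apply/implyP => /andP[]; apply: idS.
Qed.

Lemma hasse_in_sym S : ssrbool.symmetric (hasse_in le S).
Proof. by move=> x y; rewrite /hasse_in /hasse orbC andbCA. Qed.

Lemma hasse_comparable x y : hasse le x y -> le x y || le y x.
Proof. by case/orP => /andP[/andP[_ ->] _]; rewrite ?orbT. Qed.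

(** Induction on the size of the interval from [x] to [y]: unless [x = y] or [y] covers [x], some
    [z] lies strictly between them, belongs to [S] because [S] is an ideal, and leaves two smaller
    intervals. *)
Lemma le_connect S x y :
  order_ideal le S -> y \in S -> le x y -> connect (hasse_in le S) x y.
Proof.
move=> /order_idealP idS.
have [n] := ubnP #|[set z | le x z && le z y]|; elim: n x y => // n IHn x y.
move=> len yS lexy; have [<-|neq_xy] := eqVneq x y; first exact: connect0.
have [cov|] := boolP (pcover le x y).
  by apply: connect1; rewrite /hasse_in (idS x y) ?yS // /hasse cov.
rewrite /pcover /plt neq_xy lexy /= negb_forall => /existsP[z].
rewrite negbK => /andP[/andP[neq_xz lexz] /andP[neq_zy lezy]].
have zS := idS _ _ yS lezy.
apply: (@connect_trans _ _ z); apply: IHn => //; rewrite -ltnS.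
  apply: leq_trans len; rewrite ltnS; apply: proper_card; apply/properP; split.
    by apply/subsetP => u; rewrite !inE => /andP[-> /le_trans->].
  exists y; rewrite !inE ?lexy ?lexx //=.
  by apply: contra neq_zy => leyz; rewrite (le_anti lezy).
apply: leq_trans len; rewrite ltnS; apply: proper_card; apply/properP; split.
  by apply/subsetP => u; rewrite !inE => /andP[/(le_trans lexz)-> ->].
exists x; rewrite !inE ?lexy ?lexx //=.
by rewrite andbT; apply: contra neq_xz => lezx; rewrite (le_anti lexz).
Qed.

(** Comparability takes the place of Hasse edges, so that no covers have to be computed when a poset
    is modified. *)
Definition cmp_stable J K : Prop :=
  forall u v, u \in J -> u \in K -> v \in J -> le u v || le v u -> v \in K.

(** By [le_connect], Hasse connectivity and comparability connectivity agree on an ideal. The third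
    clause is an induction principle: a property passed along comparabilities in [J] spreads from
    one point to all of [J]. *)
Lemma conn_idealP J :
  reflect [/\ exists x, x \in J, forall x y, y \in J -> le x y -> x \in J &
             forall K x, x \in J -> x \in K -> cmp_stable J K -> J \subset K]
          (conn_ideal le J).
Proof.
apply: (iffP and3P) => [[/set0Pn ? idJ conn]|[exJ idJ conn]].
  split=> //; first exact/order_idealP.
  move=> K x xJ xK stK; apply/subsetP => y yJ.
  have /forallP/(_ x)/implyP/(_ xJ)/forallP/(_ y)/implyP/(_ yJ) := conn.
  apply: (connect_ind (P := fun y => y \in K)) => // u v uK.
  by case/and3P => uJ vJ /hasse_comparable; apply: stK.
have oiJ : order_ideal le J by apply/order_idealP.
split=> //; first exact/set0Pn.
apply/forallP => x; apply/implyP => xJ; apply/forallP => y; apply/implyP => yJ.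
have := conn [set z | connect (hasse_in le J) x z] x xJ.
rewrite inE connect0 => /(_ isT) conn'.
suff /subsetP/(_ _ yJ) : J \subset [set z | connect (hasse_in le J) x z].
  by rewrite inE.
apply: conn' => u v uJ; rewrite !inE => xu vJ uv; apply: connect_trans xu _.
case/orP: uv => [/(le_connect oiJ vJ) //|/(le_connect oiJ uJ)].
by rewrite (sym_connect_sym (@hasse_in_sym J)).
Qed.

(** * Components of an order ideal *)

Definition component S x : {set T} :=
  [set y in S | connect (hasse_in le S) x y].

(** [ncomp] is by definition the cardinality of this set. *)
Definition components S : {set {set T}} := [set component S x | x in S].

Lemma component_id S x : x \in S -> x \in component S x.
Proof. by move=> xS; rewrite inE xS connect0. Qed.

Lemma component_sub S x : component S x \subset S.
Proof. by apply/subsetP => y; rewrite inE => /andP[]. Qed.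

Lemma component_eq S x y : y \in component S x -> component S y = component S x.
Proof.
rewrite inE => /andP[yS xy]; apply/setP => z; rewrite !inE.
by rewrite (same_connect (sym_connect_sym (@hasse_in_sym S)) xy).
Qed.

Lemma component_stable S x u v : order_ideal le S ->
  u \in component S x -> v \in S -> le u v || le v u -> v \in component S x.
Proof.
move=> idS; rewrite !inE => /andP[uS xu] vS uv; rewrite vS.
apply: connect_trans xu _.
case/orP: uv => [/(le_connect idS vS) //|/(le_connect idS uS)].
by rewrite (sym_connect_sym (@hasse_in_sym S)).
Qed.

Lemma component_conn S x :
  order_ideal le S -> x \in S -> conn_ideal le (component S x).
Proof.
move=> idS xS; apply/conn_idealP; split.
- by exists x; apply: component_id.
- move=> u v vC leuv; apply: (component_stable idS vC); last by rewrite leuv orbT.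
  by apply: (order_idealP _ idS _ v) => //; apply: (subsetP (component_sub S x)).
move=> K y yC yK stK; apply/subsetP => z; rewrite -(component_eq yC) inE.
case/andP => zS yz; suff [] : z \in component S x /\ z \in K by [].
(* Membership in the component is carried along the path, since [K] is only known to be stable
   inside it. *)
apply: (connect_ind (P := fun z => z \in component S x /\ z \in K)) yz => //.
move=> u v [uC uK] /and3P[uS vS /hasse_comparable uv].
by have vC := component_stable idS uC vS uv; split=> //; apply: stK uv.
Qed.

Lemma conn_sub_component S J x : order_ideal le S ->
  conn_ideal le J -> J \subset S -> x \in J -> J \subset component S x.
Proof.
move=> idS /conn_idealP[_ _ conn] /subsetP JS xJ.
apply: (conn _ x) => //; first exact/component_id/JS.
by move=> u v uJ uC /JS vS; apply: component_stable.
Qed.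

Lemma components_mem S J x : J \in components S -> x \in J -> J = component S x.
Proof. by case/imsetP=> y yS -> /component_eq. Qed.

(** Once [J] meets the component [C], it lies inside [C] by [conn_sub_component]. *)
Lemma conn_components_trivial S C J : order_ideal le S ->
  C \in components S -> conn_ideal le J -> J \subset S ->
  ~~ nontriv C J.
Proof.
move=> idS CS cJ JS; apply/negP => /and3P[/set0Pn[x]].
rewrite inE => /andP[xC xJ] _ /negP[].
by rewrite (components_mem CS xC); apply: conn_sub_component.
Qed.

Lemma nontriv_sym J K : nontriv J K = nontriv K J.
Proof. by rewrite /nontriv setIC andbA andbAC -andbA. Qed.

(** * Weak P-partitions as laminar multisets of connected order ideals *)

(** A multiset of connected ideals, given by its multiplicities. The case [J = K] is harmless, since
    no set intersects itself nontrivially. *)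
Definition laminar (c : {set T} -> nat) : Prop :=
  (forall J, 0 < c J -> conn_ideal le J) /\
  (forall J K, 0 < c J -> 0 < c K -> ~~ nontriv J K).

Definition colsum (c : {set T} -> nat) (i : T) : nat :=
  \sum_(J : {set T} | i \in J) c J.

Lemma colsum_gt0P c i :
  reflect (exists2 J : {set T}, i \in J & 0 < c J) (0 < colsum c i).
Proof.
rewrite lt0n sum_nat_eq0 negb_forall; apply: (iffP existsP) => -[J].
  by rewrite negb_imply -lt0n => /andP[]; exists J.
by move=> iJ cJ; exists J; rewrite negb_imply iJ -lt0n.
Qed.

Lemma weakPPP (f : T -> nat) :
  reflect (forall i j, le i j -> f j <= f i) (weakPP le f).
Proof.
apply: (iffP forallP) => [wf i j leij|wf i].
  have [->//|neq] := eqVneq i j.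
  have /forallP/(_ j)/implyP := wf i; apply.
  by rewrite /plt neq.
by apply/forallP => j; apply/implyP => /andP[_ /wf].
Qed.

Lemma colsum_weakPP c : laminar c -> weakPP le (colsum c).
Proof.
move=> [cJ _]; apply/weakPPP => i j leij; rewrite /colsum.
rewrite big_mkcond [leqRHS]big_mkcond; apply: leq_sum => J _.
case: (ltnP 0 (c J)) => [/cJ/conn_idealP[_ idJ _]|]; last first.
  by rewrite leqn0 => /eqP->; rewrite !if_same.
by case: ifP => // /idJ/(_ leij)->.
Qed.

Lemma level_ideal (f : T -> nat) k :
  weakPP le f -> order_ideal le [set j | k <= f j].
Proof.
move=> /weakPPP wf; apply/order_idealP => x y; rewrite !inE => kfy /wf.
exact: leq_trans.
Qed.

(* The component is a maximal member of the support through [x]: laminarity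
   prevents any other member from linking it to points outside. *)
Lemma laminar_component c x : laminar c -> 0 < colsum c x ->
  0 < c (component [set i | 0 < colsum c i] x).
Proof.
move=> lam; set S := [set i | _] => cx.
have idS : order_ideal le S := level_ideal 1 (colsum_weakPP lam).
have [cJ cK] := lam; have /colsum_gt0P[J0 xJ0 cJ0] := cx.
have [J /maxsetP[/andP[xJ J_gt0] Jmax] _] :=
  maxset_exists (P := fun J => (x \in J) && (0 < c J)) (introT andP (conj xJ0 cJ0)).
suff -> : component S x = J by [].
have JS : J \subset S.
  by apply/subsetP => y yJ; rewrite inE; apply/colsum_gt0P; exists J.
apply/eqP; rewrite eqEsubset conn_sub_component ?cJ // andbT.
have /conn_idealP[_ idJ _] := cJ _ J_gt0.
have xS : x \in S by rewrite inE.
have /conn_idealP[_ _ /(_ J x)] := component_conn idS xS.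
apply=> //; first exact: component_id.
move=> u v uC uJ vC /orP[leuv|/idJ-> //].
have := subsetP (component_sub _ _) _ vC; rewrite inE => /colsum_gt0P[K vK K_gt0].
have /conn_idealP[_ idK _] := cJ _ K_gt0; have uK := idK _ _ vK leuv.
have := cK _ _ J_gt0 K_gt0; rewrite /nontriv !negb_and !negbK => /or3P[/eqP JK|JK|KJ].
- by move/setP/(_ u): JK; rewrite !inE uJ uK.
- by rewrite -(Jmax K) // K_gt0 (subsetP JK).
- exact: (subsetP KJ).
Qed.

(** Equal column sums have the same nonzero points, so by [laminar_component] both multisets contain
    the same component of that set. Remove one copy from each and use induction on the total
    multiplicity. *)
Lemma laminar_inj c d : laminar c -> laminar d -> colsum c =1 colsum d -> c =1 d.
Proof.
have [n] := ubnP (\sum_J c J); elim: n c d => // n IHn c d le_n lc ld cd.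
have zero b J : laminar b -> (forall i, colsum b i = 0) -> b J = 0.
  move=> [bJ _] b0; apply/eqP; rewrite -leqn0 leqNgt; apply/negP => J_gt0.
  have /conn_idealP[[x xJ] _ _] := bJ _ J_gt0.
  suff : 0 < colsum b x by rewrite b0.
  by apply/colsum_gt0P; exists J.
have [/forallP c0|] := boolP [forall x, colsum c x == 0].
  by move=> J; rewrite !zero // => i; rewrite -?cd; apply/eqP.
rewrite negb_forall => /existsP[x]; rewrite -lt0n => cx.
have cC := laminar_component lc cx.
have dx : 0 < colsum d x by rewrite -cd.
have := laminar_component ld dx.
have -> : [set i | 0 < colsum d i] = [set i | 0 < colsum c i].
  by apply/setP => i; rewrite !inE cd.
set C := component _ x in cC * => dC.
pose pr (b : {set T} -> nat) J := b J - (J == C).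
have pr_le b J : pr b J <= b J by apply: leq_subr.
have pr_lam b : laminar b -> laminar (pr b).
  case=> bJ bK; split=> [J|J K] /leq_trans/(_ (pr_le _ _)); first exact: bJ.
  by move=> Jb /leq_trans/(_ (pr_le _ _)); apply: bK.
have prK b J : 0 < b C -> pr b J + (J == C) = b J.
  by rewrite /pr => bC; apply: subnK; case: eqP => [->|].
have pr_sum b i : 0 < b C -> colsum (pr b) i + (i \in C) = colsum b i.
  move=> bC; rewrite /colsum.
  under [RHS]eq_bigr do rewrite -prK //.
  rewrite big_split /=; congr (_ + _).
  rewrite -big_mkcondr /= sum1_card.
  case: (boolP (i \in C)) => iC.
    rewrite (eq_card (B := pred1 C)) ?card1 // => J.
    by rewrite [LHS]unfold_in /= !inE; case: eqP => [->|]; rewrite ?iC ?andbF.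
  rewrite eq_card0 // => J; rewrite unfold_in.
  by apply/negP => /andP[iJ /eqP JC]; rewrite -JC iJ in iC.
have eq_pr : pr c =1 pr d.
  apply: IHn; [|exact: pr_lam|exact: pr_lam|].
    rewrite ltnS in le_n; apply: leq_trans le_n.
    rewrite (bigD1 C) //= [leqRHS](bigD1 C) //= -addSn.
    apply: leq_add; last by apply: leq_sum.
    by rewrite /pr eqxx subn1 prednK.
  by move=> i; apply: (@addIn (i \in C)); rewrite !pr_sum.
by move=> J; rewrite -(prK c) // -(prK d) // eq_pr.
Qed.

(** Counts the levels at which [J] is a component of the level set of [f]; the range of [k] is that
    of [nu]. *)
Definition compmult (f : T -> nat) (J : {set T}) : nat :=
  \sum_(1 <= k < (\max_i f i).+1) (J \in components [set j | k <= f j]).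

Lemma compmult_gt0P f J : 0 < compmult f J ->
  exists k, J \in components [set j | k <= f j].
Proof.
rewrite /compmult lt0n sum_nat_seq_neq0 => /hasP[k _ /=].
by rewrite eqb0 negbK; exists k.
Qed.

(** Level sets shrink as [k] grows, so a component at a higher level is a connected ideal inside
    every lower level set, and [conn_components_trivial] applies. *)
Lemma compmult_laminar f : weakPP le f -> laminar (compmult f).
Proof.
move=> wf; split=> [J|J K] /compmult_gt0P[k].
  by case/imsetP => x xS ->; apply: component_conn => //; apply: level_ideal.
move=> Jk /compmult_gt0P[l Kl].
wlog lekl : J K k l Jk Kl / k <= l => [wlogkl|].
  case/orP: (leq_total k l); first by apply: wlogkl Jk Kl.
  by rewrite nontriv_sym; apply: wlogkl Kl Jk.
apply: conn_components_trivial Jk _ _; first exact: level_ideal.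
  by case/imsetP: Kl => x xS ->; apply: component_conn => //; apply: level_ideal.
case/imsetP: Kl => x xS ->; apply: subset_trans (component_sub _ _) _.
by apply/subsetP => y; rewrite !inE; apply: leq_trans.
Qed.

(** The point [i] lies in exactly one component of the level set at [k] if [k <= f i], and in none
    otherwise. *)
Lemma colsum_compmult f : weakPP le f -> colsum (compmult f) =1 f.
Proof.
move=> wf i; rewrite /colsum /compmult exchange_big /=.
under eq_bigr => k _.
  rewrite -big_mkcondr sum1_card /=.
  rewrite (_ : #|_| = (k <= f i)); last first.
    case: (boolP (k <= f i)) => kfi.
      rewrite (eq_card (B := pred1 (component [set j | k <= f j] i))) ?card1 //.
      move=> J; rewrite [LHS]unfold_in /= inE; apply/andP/eqP => [[iJ Jk]|->].
        exact: components_mem Jk iJ.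
      by rewrite component_id ?inE //; split=> //; apply: imset_f; rewrite inE.
    rewrite eq_card0 // => J; rewrite unfold_in /=.
    apply/negP => /andP[iJ /imsetP[x _ Jx]]; move: iJ; rewrite Jx => iC.
    have := subsetP (component_sub _ _) _ iC.
    by rewrite inE (negPf kfi).
  over.
have fi_max : f i <= \max_i f i by apply: leq_bigmax.
rewrite (big_cat_nat (n := (f i).+1)) //= [X in _ + X]big_nat.
rewrite [X in _ + X]big1 => [|k].
  rewrite addn0 big_nat (eq_bigr (fun=> 1)) => [|k /andP[_]]; last first.
    by rewrite ltnS => ->.
  by rewrite -big_nat sum_nat_const_nat muln1 subSS subn0.
by case/andP; rewrite ltnNge => /negPf->.
Qed.

Lemma sum_compmult f : \sum_J compmult f J = nu le f.
Proof.
rewrite /compmult exchange_big /=; apply: eq_bigr => k _.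
by rewrite -big_mkcond sum1_card.
Qed.

End Components.

(** * Nontrivially intersecting ideals in forests with duplications *)

(** Nontrivial intersection is a matching on the connected ideals. This is the invariant carried
    through the constructions, and it makes the pairs of [PiP] disjoint. *)
Definition nontriv_matching (T : finType) (le : rel T) : Prop :=
  forall J K L, conn_ideal le J -> conn_ideal le K -> conn_ideal le L ->
    nontriv J K -> nontriv J L -> K = L.

Lemma nontrivP (T : finType) (J K : {set T}) :
  reflect [/\ exists2 x, x \in J & x \in K,
             exists2 x, x \in J & x \notin K & exists2 x, x \in K & x \notin J]
          (nontriv J K).
Proof.
apply: (iffP and3P) => [[/set0Pn[x] + /subsetPn ? /subsetPn ?]|].
  by rewrite inE => /andP[xJ xK]; split=> //; exists x.
move=> [[x xJ xK] /subsetPn ? /subsetPn ?]; split=> //.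
by apply/set0Pn; exists x; rewrite inE xJ.
Qed.

Lemma poset_iso (T U : finType) (r : rel T) (s : rel U) (g : T -> U) :
  bijective g -> (forall x y, s (g x) (g y) = r x y) -> poset r -> poset s.
Proof.
move=> [h gK hK] gs [rr ra rt]; split=> [x|x y|y x z].
- by rewrite -(hK x) gs.
- by rewrite -(hK x) -(hK y) !gs => /ra->.
- by rewrite -(hK x) -(hK y) -(hK z) !gs; apply: rt.
Qed.

Lemma matching_iso (T U : finType) (r : rel T) (s : rel U) (g : T -> U) :
  poset r -> bijective g -> (forall x y, s (g x) (g y) = r x y) ->
  nontriv_matching r -> nontriv_matching s.
Proof.
move=> rP gB gs match_r; have sP := poset_iso gB gs rP.
have [h gK hK] := gB.
have conn J : conn_ideal s J -> conn_ideal r (g @^-1: J).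
  case/(conn_idealP sP) => [[x xJ] idJ conn]; apply/(conn_idealP rP); split.
  - by exists (h x); rewrite inE hK.
  - by move=> u v; rewrite !inE -gs; apply: idJ.
  move=> K u; rewrite inE => uJ uK stK.
  have /subsetP JK : J \subset h @^-1: K.
    apply: (conn _ (g u)); rewrite ?inE ?gK // => v w vJ; rewrite !inE => vK wJ vw.
    by apply: (stK (h v)); rewrite ?inE ?hK // -!gs !hK.
  by apply/subsetP => v; rewrite inE => /JK; rewrite inE gK.
have nt J K : nontriv J K -> nontriv (g @^-1: J) (g @^-1: K).
  case/nontrivP=> -[x xJ xK] [y yJ yK] [z zK zJ]; apply/nontrivP.
  by split; [exists (h x)|exists (h y)|exists (h z)]; rewrite !inE hK.
move=> J K L /conn cJ /conn cK /conn cL /nt JK /nt JL.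
have /setP KL := match_r _ _ _ cJ cK cL JK JL.
by apply/setP => x; have := KL (h x); rewrite !inE hK.
Qed.

(** * Disjoint unions and hangings *)

Section Hang.
Variables (T1 T2 : finType) (r1 : rel T1) (r2 : rel T2) (oa : option T1).
Hypotheses (P1 : poset r1) (P2 : poset r2).

(* [None] gives the disjoint union, [Some a] hangs [T2] below [a]. *)
Definition hang_opt_rel : rel (T1 + T2) :=
  fun u v => match u, v with
             | inl x, inl y => r1 x y
             | inr x, inr y => r2 x y
             | inr _, inl b => if oa is Some a then r1 a b else false
             | inl _, inr _ => false
             end.

Lemma poset_hang_opt : poset hang_opt_rel.
Proof.
case: P1 P2 => [rr1 ra1 rt1] [rr2 ra2 rt2]; rewrite /hang_opt_rel.
split=> [[x|x]|[x|x] [y|y]|[y|y] [x|x] [z|z]] //=.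
- by move/ra1->.
- by rewrite andbF.
- by move/ra2->.
- exact: rt1.
- by case: oa => // a; apply: rt1.
- exact: rt2.
Qed.

Implicit Types J K L : {set T1 + T2}.
Let lpart J := inl @^-1: J : {set T1}.
Let rpart J := inr @^-1: J : {set T2}.
Let full J := if oa is Some a then inl a \in J else false.

(** Every link between the two sides ends at some [b] above [a], so downward closure puts [a], and
    with it all of [T2], into [J]; without [a] no link leaves [T1]. *)
Lemma hang_conn_lpart J x : conn_ideal hang_opt_rel J -> inl x \in J ->
  conn_ideal r1 (lpart J) /\ forall y, (inr y \in J) = full J.
Proof.
case/(conn_idealP poset_hang_opt) => _ idJ conn xJ; have [rr1 _ _] := P1.
have fullI y z : inl y \in J -> hang_opt_rel (inr z) (inl y) -> full J.
  by rewrite /full /=; case oaE: oa => [a|] // yJ ay; apply: idJ yJ _.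
split; last first.
  move=> y; apply/idP/idP => [yJ|]; last first.
    rewrite /full; case oaE: oa => [a|] // aJ.
    by apply: idJ aJ _; rewrite /= oaE rr1.
  apply: contraT => nfull.
  have /subsetP/(_ _ yJ) : J \subset [set u | if u is inl _ then true else false].
    apply: (conn _ (inl x)); rewrite ?inE //.
    move=> [u|u] [v|v]; rewrite ?inE //= => uJ _ vJ uv.
    by rewrite (fullI u v) in nfull.
  by rewrite inE.
apply/(conn_idealP P1); split.
- by exists x; rewrite inE.
- by move=> u v; rewrite !inE => vJ uv; apply: idJ vJ _.
move=> K u; rewrite inE => uJ uK stK.
(* The points of [T2] inherit the status of [a]: a link from [T2] to some [b] above [a] is rerouted
   through [a]. *)
pose K' : {set T1 + T2} := [set w | match w with
  | inl w => w \in K | inr _ => if oa is Some a then a \in K else false end].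
have /subsetP JK : J \subset K'.
  apply: (conn _ (inl u)); rewrite ?inE //.
  move=> [v|v] [w|w]; rewrite ?inE //= => vJ vK wJ vw.
  - by apply: stK vK _ vw; rewrite inE.
  - case oaE: oa vw => [a|] //= av.
    by apply: stK vK _ _; rewrite ?inE ?av ?orbT //; apply: idJ vJ _.
  - case oaE: oa vw vK => [a|] //=; rewrite orbF => aw aK.
    by apply: stK aK _ _; rewrite ?inE ?aw //; apply: idJ wJ _.
by apply/subsetP => w; rewrite inE => /JK; rewrite inE.
Qed.

Lemma hang_conn_rpart J : conn_ideal hang_opt_rel J ->
  (forall x, inl x \notin J) -> conn_ideal r2 (rpart J).
Proof.
case/(conn_idealP poset_hang_opt) => [[x xJ]] idJ conn noleft.
apply/(conn_idealP P2); split.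
- by case: x xJ => x xJ; [have := noleft x; rewrite xJ|exists x; rewrite inE].
- by move=> u v; rewrite !inE => vJ uv; apply: idJ vJ _.
move=> K u; rewrite inE => uJ uK stK.
have /subsetP JK : J \subset inr @: K.
  apply: (conn _ (inr u)); rewrite ?imset_f // => v w vJ /imsetP[v' vK vE] wJ.
  case: w wJ => w wJ; first by have := noleft w; rewrite wJ.
  rewrite vE /= => vw; rewrite imset_f //; apply: stK vK _ vw; rewrite inE //.
  by rewrite -vE.
apply/subsetP => w; rewrite inE => /JK; rewrite mem_imset //.
exact: inr_inj.
Qed.

(** Since [J] contains all of [T2] or none of it, a [K] inside [T2] would be contained in [J] or
    disjoint from it. Once [K] meets [T1] as well, both are all-or-nothing on [T2], and a witness
    there can be replaced by [a]. *)
Lemma hang_nontriv_lpart J K x : conn_ideal hang_opt_rel J ->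
  conn_ideal hang_opt_rel K -> inl x \in J -> nontriv J K ->
  (exists y, inl y \in K) /\ nontriv (lpart J) (lpart K).
Proof.
move=> cJ cK xJ /nontrivP[[u uJ uK] [v vJ vK] [w wK wJ]].
have [_ rJ] := hang_conn_lpart cJ xJ.
have [/existsP[y yK]|/existsPn noK] := boolP [exists y, inl y \in K]; last first.
  case: u uJ uK => u uJ uK; first by have := noK u; rewrite uK.
  case: w wK wJ => w wK wJ; first by have := noK w; rewrite wK.
  by rewrite rJ -(rJ u) uJ in wJ.
have [_ rK] := hang_conn_lpart cK yK.
split; first by exists y.
apply/nontrivP; split.
- case: u uJ uK => u; first by exists u; rewrite inE.
  by rewrite rJ rK /full; case: oa => // a; exists a; rewrite inE.
- case: v vJ vK => v; first by exists v; rewrite inE.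
  by rewrite rJ rK /full; case: oa => // a; exists a; rewrite inE.
- case: w wJ wK => w; first by exists w; rewrite inE.
  by rewrite rJ rK /full; case: oa => // a; exists a; rewrite inE.
Qed.

(** If [J] meets [T1], so do its partners, which are recovered from their left parts; otherwise
    everything takes place in [T2]. *)
Lemma matching_hang_opt :
  nontriv_matching r1 -> nontriv_matching r2 -> nontriv_matching hang_opt_rel.
Proof.
move=> match1 match2 J K L cJ cK cL JK JL.
have [/existsP[x xJ]|/existsPn noJ] := boolP [exists y, inl y \in J].
  have [cJl _] := hang_conn_lpart cJ xJ.
  have [[y yK] JKl] := hang_nontriv_lpart cJ cK xJ JK.
  have [[z zL] JLl] := hang_nontriv_lpart cJ cL xJ JL.
  have [cKl rK] := hang_conn_lpart cK yK.
  have [cLl rL] := hang_conn_lpart cL zL.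
  have /setP KL := match1 _ _ _ cJl cKl cLl JKl JLl.
  have KLl w : (inl w \in K) = (inl w \in L) by have := KL w; rewrite !inE.
  apply/setP => -[w|w] //; rewrite rK rL /full.
  by case: oa => // a; rewrite KLl.
have noleft M : conn_ideal hang_opt_rel M -> nontriv J M ->
    forall x, inl x \notin M.
  move=> cM JM x; apply/negP => xM; rewrite nontriv_sym in JM.
  by have [[y yJ] _] := hang_nontriv_lpart cM cJ xM JM; have := noJ y; rewrite yJ.
have ntr M : conn_ideal hang_opt_rel M -> nontriv J M ->
    nontriv (rpart J) (rpart M).
  move=> cM JM; have noM := noleft M cM JM.
  case/nontrivP: JM => -[u uJ uM] [v vJ vM] [w wM wJ].
  apply/nontrivP; split.
  - by case: u uJ uM => u uJ; [have := noJ u; rewrite uJ|exists u; rewrite inE].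
  - by case: v vJ vM => v vJ; [have := noJ v; rewrite vJ|exists v; rewrite inE].
  - by case: w wM wJ => w wM; [have := noM w; rewrite wM|exists w; rewrite inE].
have noK := noleft K cK JK; have noL := noleft L cL JL.
have /setP KL := match2 _ _ _ (hang_conn_rpart cJ noJ) (hang_conn_rpart cK noK)
  (hang_conn_rpart cL noL) (ntr K cK JK) (ntr L cL JL).
apply/setP => -[w|w]; first by rewrite (negPf (noK w)) (negPf (noL w)).
by have := KL w; rewrite !inE.
Qed.

End Hang.

(** * Duplication of a hanger *)

Section Duplicate.
Variables (T : finType) (r : rel T) (a : T).
Hypotheses (rP : poset r) (ha : hanger r a).

Let rr x : r x x. Proof. by case: rP. Qed.
Let ra x y : r x y -> r y x -> x = y.
Proof. by case: rP => _ anti _ xy yx; apply: anti; rewrite xy. Qed.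
Let rt y x z : r x y -> r y z -> r x z.
Proof. by case: rP => _ _; apply. Qed.

Let plt_le x y : plt r x y -> r x y. Proof. by case/andP. Qed.
Let plt_le_trans y x z : plt r x y -> r y z -> plt r x z.
Proof.
case/andP=> neq xy yz; rewrite /plt (rt xy yz) andbT.
by apply: contra neq => /eqP xz; rewrite (ra xy) // xz.
Qed.
Let le_plt_trans y x z : r x y -> plt r y z -> plt r x z.
Proof.
move=> xy /andP[neq yz]; rewrite /plt (rt xy yz) andbT.
by apply: contra neq => /eqP xz; rewrite (ra yz) // -xz.
Qed.
Let plt_irr x : plt r x x = false. Proof. by rewrite /plt eqxx. Qed.

Lemma poset_dup : poset (dup_rel r a).
Proof.
split=> [[x|] //=|[x|] [y|] //=|[y|] [x|] [z|] //=].
- by case/andP=> /ra h /h->.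
- by case/andP => xa /plt_le/(plt_le_trans xa); rewrite plt_irr.
- by case/andP => ay /plt_le/(plt_le_trans ay); rewrite plt_irr.
- exact: rt.
- exact: le_plt_trans.
- exact: plt_le_trans.
- by move=> /plt_le xa /plt_le; apply: rt.
Qed.

(** The down-set of [y] contains a Hasse path from [x] to [y]; the hanger condition puts [a] on it,
    hence below [y]. *)
Lemma hanger_between x y : plt r x a -> r x y -> ~~ r y a -> r a y.
Proof.
move=> xa xy nya; case: ha => _ /(_ x y) path_a.
have idS : order_ideal r [set z | r z y].
  by apply/order_idealP => u v; rewrite !inE => vy uv; apply: rt vy.
have yS : y \in [set z | r z y] by rewrite inE.
have /connectP[p pathp lastp] := le_connect rP idS yS xy.
have /path_a/(_ nya) {}path_a := xa.
have /path_a/(_ (esym lastp)) : path (hasse r) x p.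
  by apply: sub_path pathp => u v /and3P[].
suff /allP sub : all (fun z => r z y) (x :: p) by move/sub.
rewrite /= xy /= {lastp path_a nya xa xy}; elim: p x pathp => //= z p IHp x.
by case/andP => /and3P[_ + _] /IHp ->; rewrite inE => ->.
Qed.

Implicit Types J K L : {set option T}.
Let old J := Some @^-1: J : {set T}.
(** Such a [J] does not separate [a] from its copy, so it is determined by its trace [old J]. *)
Let regular J := (None \in J) == (Some a \in J).

(** The copy is related to the other elements exactly as [a] is, so inside a regular [J] every link
    through the copy can use [a] instead. *)
Lemma dup_conn_old J : conn_ideal (dup_rel r a) J -> regular J ->
  conn_ideal r (old J).
Proof.
move=> /(conn_idealP poset_dup)[[x xJ] idJ conn] /eqP reg.
apply/(conn_idealP rP); split.
- case: x xJ => [x|] xJ; first by exists x; rewrite inE.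
  by exists a; rewrite inE -reg.
- by move=> u v; rewrite !inE => vJ uv; apply: idJ vJ _.
move=> K u; rewrite inE => uJ uK stK.
have /subsetP JK : J \subset
    [set w | if w is Some w then w \in K else a \in K].
  apply: (conn _ (Some u)); rewrite ?inE //.
  move=> [v|] [w|]; rewrite ?inE //= => vJ vK wJ vw.
  - by apply: stK vK _ vw; rewrite inE.
  - apply: stK vK _ _; rewrite ?inE -?reg //.
    by case/orP: vw => /plt_le->; rewrite ?orbT.
  - apply: stK vK _ _; rewrite ?inE -?reg //.
    by case/orP: vw => /plt_le->; rewrite ?orbT.
by apply/subsetP => w; rewrite inE => /JK; rewrite inE.
Qed.

(* Irregular connected ideals are exactly the principal ideals of [a] and of
   its copy. *)
Lemma dup_irregular J x : conn_ideal (dup_rel r a) J -> ~~ regular J ->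
  x != a -> (Some x \in J) = r x a.
Proof.
move=> /(conn_idealP poset_dup)[_ idJ conn] irreg xa.
(* An element strictly above [a] is also above the copy, so it would bring both into [J]. *)
have above y : Some y \in J -> r a y -> y = a.
  move=> yJ ay; apply/eqP; apply: contraNT irreg => ya.
  rewrite /regular (idJ (Some a) _ yJ ay) (idJ None _ yJ) //=.
  by rewrite /plt eq_sym ya.
apply/idP/idP => [xJ|rxa]; last first.
  have pxa : plt r x a by rewrite /plt xa.
  have [NJ|NJ] := boolP (None \in J); first by apply: idJ NJ _.
  have [aJ|aJ] := boolP (Some a \in J); first by apply: idJ aJ _.
  by move: irreg; rewrite /regular (negPf NJ) (negPf aJ).
pose K : {set option T} := [set w | if w is Some w then r w a else true].
suff /subsetP/(_ _ xJ) : J \subset K by rewrite inE.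
have [y yJ yK] : exists2 y, y \in J & y \in K.
  have [NJ|NJ] := boolP (None \in J); first by exists None; rewrite ?inE.
  exists (Some a); rewrite ?inE //.
  by apply: contraNT irreg => aJ; rewrite /regular (negPf NJ) (negPf aJ).
(* A step up from [u] below [a] to a [v] outside the down-set of [a] would put [v] above [a], by
   [hanger_between] when [u] differs from [a]; [above] excludes this. *)
apply: (conn _ y) => // -[u|] [v|]; rewrite ?inE //= => uJ uK vJ.
  case/orP=> [uv|vu]; last exact: rt uK.
  apply: contraT => nva; have [ua|ua] := eqVneq u a.
    by rewrite (above v) ?rr // -ua in nva.
  have av : r a v by apply: hanger_between uv nva; rewrite /plt ua.
  by rewrite (above v) ?rr in nva.
by case/orP => /plt_le // av; rewrite (above v).
Qed.

(** An irregular [K] consists of the elements strictly below [a] and one of the two copies. If [J]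
    contains both copies, it contains [K]. If it contains neither, it meets [K] strictly below [a]
    and cannot leave the down-set of [a] without passing through [a], so it lies inside [K]. *)
Lemma dup_regular_nontriv J K : conn_ideal (dup_rel r a) J ->
  conn_ideal (dup_rel r a) K -> regular J -> nontriv J K -> regular K.
Proof.
move=> cJ cK regJ /nontrivP[[u uJ uK] [v vJ vK] [w wK wJ]].
apply: contraT => irK; have Kp x := dup_irregular (x := x) cK irK.
have [aJ|aJ] := boolP (Some a \in J).
  have NJ : None \in J by rewrite (eqP regJ).
  case/(conn_idealP poset_dup): cJ => _ idJ _.
  case/negP: wJ; case: w wK => // w wK; have [->//|wa] := eqVneq w a.
  by apply: idJ aJ _ => /=; rewrite -Kp.
have NJ : None \notin J by rewrite (eqP regJ).
have neq x : Some x \in J -> x != a by apply: contraTneq => ->.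
case: u uJ uK => [u|] uJ uK; last by rewrite uJ in NJ.
case: v vJ vK => [v|] vJ vK; last by rewrite vJ in NJ.
have /(conn_idealP rP)[_ idJ conn] := dup_conn_old cJ regJ.
rewrite Kp ?neq // in uK; rewrite Kp ?neq // in vK.
have /subsetP/(_ v) : old J \subset [set x | r x a].
  apply: (conn _ u); rewrite ?inE // => x y; rewrite !inE => xJ xa yJ.
  case/orP=> [xy|yx]; last exact: rt xa.
  apply: contraT => nya; have ay : r a y.
    by apply: hanger_between xy nya; rewrite /plt neq.
  by have := idJ a y; rewrite !inE (negPf aJ) => /(_ yJ ay).
by rewrite !inE (negPf vK) => /(_ vJ).
Qed.

(** Partners are both regular or both irregular. The regular case reduces to [r] by taking traces.
    An irregular ideal is determined by whether it contains the copy, so at most one other can be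
    its partner. *)
Lemma matching_dup : nontriv_matching r -> nontriv_matching (dup_rel r a).
Proof.
move=> match_r J K L cJ cK cL JK JL.
have [regJ|irJ] := boolP (regular J).
  have nt M : conn_ideal (dup_rel r a) M -> nontriv J M ->
      regular M /\ nontriv (old J) (old M).
    move=> cM JM; have regM := dup_regular_nontriv cJ cM regJ JM.
    split=> //; case/nontrivP: JM => -[u uJ uM] [v vJ vM] [w wM wJ].
    apply/nontrivP; split.
    - case: u uJ uM => [u|]; first by exists u; rewrite inE.
      by rewrite (eqP regJ) (eqP regM); exists a; rewrite inE.
    - case: v vJ vM => [v|]; first by exists v; rewrite inE.
      by rewrite (eqP regJ) (eqP regM); exists a; rewrite inE.
    - case: w wJ wM => [w|]; first by exists w; rewrite inE.
      by rewrite (eqP regJ) (eqP regM); exists a; rewrite inE.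
  have [regK JKo] := nt K cK JK; have [regL JLo] := nt L cL JL.
  have /setP KL := match_r _ _ _ (dup_conn_old cJ regJ) (dup_conn_old cK regK)
    (dup_conn_old cL regL) JKo JLo.
  have KLs x : (Some x \in K) = (Some x \in L) by have := KL x; rewrite !inE.
  by apply/setP => -[x|] //; rewrite (eqP regK) (eqP regL).
have irr M : conn_ideal (dup_rel r a) M -> nontriv J M -> ~~ regular M.
  move=> cM JM; apply: contra irJ => regM; rewrite nontriv_sym in JM.
  exact: dup_regular_nontriv cM cJ regM JM.
have ext M N : conn_ideal (dup_rel r a) M -> conn_ideal (dup_rel r a) N ->
    ~~ regular M -> ~~ regular N -> (None \in M) = (None \in N) -> M = N.
  move=> cM cN irM irN NMN; apply/setP => -[x|] //.
  have [->|xa] := eqVneq x a; last by rewrite !dup_irregular.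
  move: irM irN; rewrite /regular NMN.
  by case: (None \in N) (Some a \in M) (Some a \in N) => [] [] [].
have neq M : conn_ideal (dup_rel r a) M -> nontriv J M ->
    (None \in M) = ~~ (None \in J).
  move=> cM JM; have irM := irr M cM JM.
  have : J <> M by move=> JE; case/nontrivP: JM => _ [x xJ]; rewrite -JE xJ.
  by case: (boolP (None \in M)) (boolP (None \in J)) => NM [] NJ // [];
    apply: ext => //; rewrite ?(negPf NM) ?(negPf NJ) ?NM ?NJ.
by apply: ext => //; [exact: irr|exact: irr|rewrite (neq K) // (neq L)].
Qed.

End Duplicate.

Lemma forest_dup_matching (T : finType) (le : rel T) :
  forest_dup le -> poset le /\ nontriv_matching le.
Proof.
elim=> {T le} [T T1|T U r s g gB gs _ [rP rM]|T1 T2 r1 r2 _ [P1 M1] _ [P2 M2]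
  |T1 T2 r1 r2 a _ [P1 M1] _ [P2 M2]|T r a _ [rP rM] ha].
- split; first by split=> [x|x y /andP[/eqP]|y x z /eqP->].
  move=> J K L _ _ _ /nontrivP[[x xJ xK] [y yJ yK] _] _.
  have /card_le1_eqP/(_ x y) : #|T| <= 1 by rewrite T1.
  by move=> xy; move: yK; rewrite xy ?xK // inE.
- by split; [apply: poset_iso gB gs rP|apply: matching_iso gB gs rM].
- split; first exact: (poset_hang_opt None P1 P2).
  exact: (matching_hang_opt (oa := None) P1 P2 M1 M2).
- split; first exact: (poset_hang_opt (Some a) P1 P2).
  exact: (matching_hang_opt (oa := Some a) P1 P2 M1 M2).
- by split; [apply: poset_dup|apply: matching_dup].
Qed.

(** * Multisets avoiding disjoint sets *)

Section IndependentSums.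
Variables (R : comNzRingType) (K : R -> Prop).
Hypotheses (K0 : K 0%R) (KD : forall x y, K x -> K y -> K (x + y)%R).
Hypothesis KM : forall a x, K x -> K (a * x)%R.
Local Open Scope ring_scope.

(** Congruence modulo the ideal [K], which in the applications consists of the polynomials without
    terms of degree up to a fixed bound. *)
Let cong x y := K (x - y).

Lemma ideal_congM x y u v : cong x y -> cong u v -> cong (x * u) (y * v).
Proof.
move=> xy uv; rewrite /cong.
have -> : x * u - y * v = u * (x - y) + y * (u - v).
  by rewrite !mulrBr (mulrC u x) (mulrC u y) addrA subrK.
by apply: KD; apply: KM.
Qed.

Lemma ideal_congD x y u v : cong x y -> cong u v -> cong (x + u) (y + v).
Proof. by move=> xy uv; rewrite /cong opprD addrACA; apply: KD. Qed.

Lemma ideal_cong_refl x : cong x x.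
Proof. by rewrite /cong subrr. Qed.

Variables (I : finType) (S : {set I}) (P : {set {set I}}) (z : I -> R) (D : nat).

(** Multiplicities are capped at [D] to keep the sums finite; the error involves only the powers
    [z i ^+ D.+1]. *)
Definition bsupp (c : {ffun I -> 'I_D.+1}) : {set I} :=
  [set i | (0 < c i)%N].

Definition avoiding (c : {ffun I -> 'I_D.+1}) : bool :=
  (bsupp c \subset S) && [forall Q in P, ~~ (Q \subset bsupp c)].

(** The flag [b] forces the index into the support: dropping the term [k = 0] turns the leading [1]
    into [x]. *)
Lemma geometric_sum_from (x : R) (b : bool) :
  (\sum_(k < D.+1 | b ==> (0 < k)%N) x ^+ k) * (1 - x)
    = (if b then x else 1) - x ^+ D.+1.
Proof.
have all : (\sum_(k < D.+1) x ^+ k) * (1 - x) = 1 - x ^+ D.+1.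
  by rewrite mulrC -opprB mulNr -subrX1 opprB.
case: b => //=; move: all; rewrite (bigD1 ord0) //= expr0 mulrDl mul1r.
under eq_bigl do rewrite -val_eqE /= -lt0n.
by move/(canRL (addKr _)) ->; rewrite opprB addrA subrK.
Qed.

(* Inclusion-exclusion over the sets [Q] of [P] contained in the support;
   disjointness of the [Q] makes each term factor. *)
Lemma avoiding_sum_cong : trivIset P -> cover P \subset S ->
  (forall i, i \in S -> K (z i ^+ D.+1)) ->
  cong ((\sum_(c | avoiding c) \prod_i z i ^+ c i) * \prod_(i in S) (1 - z i))
       (\prod_(Q in P) (1 - \prod_(i in Q) z i)).
Proof.
move=> tiP PS Kz.
pose sgn (E : {set {set I}}) : R := \prod_(Q in E) (-1).
have expand (y : {set I} -> R) : \prod_(Q in P) (1 - y Q) =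
    \sum_(E : {set {set I}} | E \subset P) sgn E * \prod_(Q in E) y Q.
  rewrite big_mkcond.
  transitivity (\prod_Q ((if Q \in P then - y Q else 0) + 1)).
    by apply: eq_bigr => Q _; case: ifP => _; rewrite ?add0r // addrC.
  rewrite (bigA_distr _ _ (fun Q => if Q \in P then - y Q else 0) (fun=> 1)) /=.
  rewrite [RHS]big_mkcond; apply: eq_bigr => E _; case: ifPn => EP.
    rewrite -big_split [RHS]big_mkcond /=; apply: eq_bigr => Q _.
    by case: ifP => // /(subsetP EP)->; rewrite mulN1r.
  case/subsetPn: EP => Q QE QP.
  by rewrite (bigD1 Q) //= QE (negPf QP) mul0r.
(* Write avoidance as the product of the factors [1 - (Q \subset bsupp c)%:R] and expand; all [Q] in
   [E] lie in the support exactly when [cover E] does. *)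
have -> : \sum_(c | avoiding c) \prod_i z i ^+ c i =
    \sum_(E : {set {set I}} | E \subset P) sgn E *
      \sum_(c | (bsupp c \subset S) && (cover E \subset bsupp c)) \prod_i z i ^+ c i.
  under [RHS]eq_bigr do rewrite big_distrr big_mkcondr /=.
  rewrite exchange_big /= big_mkcondr; apply: eq_bigr => c _.
  transitivity ((\prod_(Q in P) (1 - (Q \subset bsupp c)%:R)) * \prod_i z i ^+ c i).
    case: ifPn => [/forall_inP av|].
      by rewrite [X in X * _]big1 ?mul1r // => Q /av/negPf->; rewrite subr0.
    rewrite negb_forall => /existsP[Q]; rewrite negb_imply negbK => /andP[QP Qc].
    by rewrite (bigD1 Q) //= Qc subrr !mul0r.
  rewrite expand big_distrl /=; apply: eq_bigr => E _.
  case: ifPn => [/bigcupsP Ec|].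
    by rewrite [X in _ * X * _]big1 ?mulr1 // => Q /Ec->.
  have [/forall_inP Ec|] := boolP [forall Q in E, Q \subset bsupp c].
    by case/negP; apply/bigcupsP.
  rewrite negb_forall => /existsP[Q]; rewrite negb_imply => /andP[QE /negPf Qc] _.
  by rewrite [X in _ * X * _](bigD1 Q) //= Qc mul0r mulr0 mul0r.
rewrite expand big_distrl /=.
apply: (big_ind2 cong); [exact: ideal_cong_refl|exact: ideal_congD|].
move=> E EP; rewrite -mulrA; apply: ideal_congM; first exact: ideal_cong_refl.
(* Disjointness of the sets [Q] is used here: each index of [cover E] occurs once. *)
have -> : \prod_(Q in E) \prod_(i in Q) z i
        = \prod_(i in S) (if i \in cover E then z i else 1).
  rewrite -(big_trivIset E); last by apply: trivIsetS tiP.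
  rewrite -big_mkcondr; apply: eq_bigl => i; rewrite andbC.
  apply/idP/andP => [iE|[]//]; split=> //; apply: (subsetP PS).
  by apply: subsetP iE; apply/bigcupsP => Q /(subsetP EP); apply: bigcup_sup.
(* The exponents allowed at [i], chosen independently for each index, so that the sum becomes a
   product of geometric sums. *)
pose b i k := if i \in S then (i \in cover E) ==> (0 < k)%N else k == 0%N.
have -> : \sum_(c | (bsupp c \subset S) && (cover E \subset bsupp c))
            \prod_i z i ^+ c i
        = \prod_(i in S) \sum_(k < D.+1 | (i \in cover E) ==> (0 < k)%N) z i ^+ k.
  transitivity (\prod_i \sum_(k < D.+1 | b i k) z i ^+ k).
    rewrite bigA_distr_big_dep; apply: eq_bigl => c; apply/andP/familyP.
      move=> [/subsetP cS /subsetP Ec] i; rewrite unfold_in /b; case: ifPn => iS.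
        by apply/implyP => /Ec; rewrite inE.
      by rewrite -leqn0 leqNgt; apply: contra iS => ci; apply: cS; rewrite inE.
    move=> bc; split; apply/subsetP => i; have := bc i; rewrite unfold_in /b inE.
      by case: ifP => // _ /eqP->.
    move=> + iE; rewrite iE (subsetP PS) //.
    by apply: subsetP iE; apply/bigcupsP => Q /(subsetP EP); apply: bigcup_sup.
  rewrite [RHS]big_mkcond; apply: eq_bigr => i _; rewrite /b; case: ifP => // _.
  by rewrite (big_pred1 ord0) ?expr0 // => k.
rewrite -big_split /=.
apply: (big_ind2 cong); [exact: ideal_cong_refl|exact: ideal_congM|].
(* The two factors at [i] differ by [- z i ^+ D.+1]. *)
move=> i iS; rewrite geometric_sum_from /cong addrAC subrr add0r -mulN1r.
exact/KM/Kz.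
Qed.

End IndependentSums.

(** * Generating series *)

Lemma PiP_mem (T : finType) (le : rel T) (Q : {set {set T}}) (J : {set T}) :
  Q \in PiP le -> J \in Q -> exists K,
    [/\ Q = [set J; K], conn_ideal le J, conn_ideal le K & nontriv J K].
Proof.
rewrite inE => /and3P[/cards2P[A [B [AB ->]]]].
rewrite subUset !sub1set !inE => /andP[cA cB] /forall_inP nt.
have /nt/forall_inP/(_ B) : A \in [set A; B] by rewrite !inE eqxx.
rewrite !inE eqxx orbT AB => /(_ isT) /= ntAB.
by case/orP => /eqP->; [exists B|exists A; rewrite nontriv_sym setUC].
Qed.

(** An ideal shared by two pairs has the same unique partner in both. *)
Lemma PiP_trivIset (T : finType) (le : rel T) :
  nontriv_matching le -> trivIset (PiP le).
Proof.
move=> match_le; apply/trivIsetP => Q Q' PQ PQ'.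
apply: contraNT => /pred0Pn[J /andP[]] /= /(PiP_mem PQ)[K [-> cJ cK JK]].
by case/(PiP_mem PQ') => L [-> _ cL JL]; rewrite (match_le J K L).
Qed.

Lemma eq_weakPP (T : finType) (le : rel T) (f g : T -> nat) :
  f =1 g -> weakPP le f = weakPP le g.
Proof.
by move=> fg; apply: eq_forallb => i; apply: eq_forallb => j; rewrite !fg.
Qed.

Lemma eq_nu (T : finType) (le : rel T) (f g : T -> nat) :
  f =1 g -> nu le f = nu le g.
Proof.
move=> fg; rewrite /nu (eq_bigr g) => [|i _]; last exact: fg.
by apply: eq_bigr => k _; congr ncomp; apply/setP => j; rewrite !inE fg.
Qed.

Section Generating.
Variables (T : finType) (le : rel T).
Hypothesis leP : poset le.

Lemma avoiding_laminarP (D : nat) (c : {ffun {set T} -> 'I_D.+1}) :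
  reflect (laminar le (fun J => c J)) (avoiding (Jconn le) (PiP le) c).
Proof.
apply: (iffP andP) => [[/subsetP cS /forall_inP av]|[cS cN]].
  have sup J : 0 < c J -> conn_ideal le J.
    by move=> cJ; have := cS J; rewrite !inE; apply.
  split=> // J K cJ cK; apply/negP => JK.
  have neqJK : J != K.
    by apply: contraTneq JK => ->; rewrite /nontriv subxx andbF.
  have /av/negP[] : [set J; K] \in PiP le.
    rewrite inE cards2 neqJK eqxx subUset !sub1set !inE !sup //=.
    apply/forall_inP => A; rewrite !inE => /orP[]/eqP->;
      apply/forall_inP => B; rewrite !inE => /orP[]/eqP->;
      by rewrite ?eqxx // ?JK ?implybT // nontriv_sym JK implybT.
  by rewrite subUset !sub1set !inE cJ cK.
split; first by apply/subsetP => J; rewrite !inE; apply: cS.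
apply/forall_inP => Q; rewrite inE => /and3P[/cards2P[J [K [neqJK ->]]] _].
move=> /forall_inP/(_ J); rewrite !inE eqxx => /(_ isT)/forall_inP/(_ K).
rewrite !inE eqxx orbT neqJK => /(_ isT) /= JK; rewrite subUset !sub1set !inE.
by apply/negP => /andP[cJ cK]; have := cN _ _ cJ cK; rewrite JK.
Qed.

Lemma sum_colsum (c : {set T} -> nat) :
  (\sum_i colsum c i = \sum_J c J * #|J|)%N.
Proof.
rewrite /colsum (exchange_big_dep xpredT) //=; apply: eq_bigr => J _.
by rewrite sum_nat_const mulnC.
Qed.

(** By uniqueness, [c] is the level-set decomposition of its own column sums. *)
Lemma laminar_nu (c : {set T} -> nat) :
  laminar le c -> nu le (colsum c) = \sum_J c J.
Proof.
move=> lam; rewrite -sum_compmult; apply: eq_bigr => J _.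
have wc := colsum_weakPP leP lam.
apply: (laminar_inj leP) => //; first exact: compmult_laminar.
exact: colsum_compmult.
Qed.

End Generating.

Local Open Scope ring_scope.

(** * The two identities, coefficient by coefficient *)

Section Specialization.
Variables (n : nat) (le : rel 'I_n).
Hypotheses (leP : poset le) (match_le : nontriv_matching le).

(** The weight of [J] is the monomial of [t] and [J] in the first identity and ['X^#|J|] in the
    second. *)
Let ideals_sum (R : comNzRingType) (z : {set 'I_n} -> R) (D : nat) : R :=
  \sum_(c : {ffun {set 'I_n} -> 'I_D.+1} | avoiding (Jconn le) (PiP le) c)
    \prod_J z J ^+ c J.

Lemma cover_PiP : cover (PiP le) \subset Jconn le.
Proof. by apply/bigcupsP => Q; rewrite inE => /and3P[]. Qed.

Definition ideal_mnm (J : {set 'I_n}) : 'X_{1..n.+1} :=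
  (U_(ord_max) + \sum_(j in J) U_(widen_ord (leqnSn n) j))%MM.

Lemma tvar_xJ J : tvar n * xJ J = 'X_[ideal_mnm J].
Proof. by rewrite /ideal_mnm mpolyXD /tvar /xJ /xvar mprodXE. Qed.

Lemma ideal_mnm_max J : ideal_mnm J ord_max = 1%N.
Proof.
rewrite mnmDE mnm1E eqxx mnm_sumE big1 // => j _.
by rewrite mnm1E -val_eqE /= ltn_eqF.
Qed.

Lemma ideal_mnm_widen J i :
  ideal_mnm J (widen_ord (leqnSn n) i) = (i \in J) :> nat.
Proof.
rewrite mnmDE mnm1E -val_eqE /= gtn_eqF // add0n mnm_sumE.
transitivity (\sum_(j in J) (j == i))%N.
  by apply: eq_bigr => j _; rewrite mnm1E -val_eqE.
rewrite -big_mkcondr sum1_card /=; case: (boolP (i \in J)) => iJ.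
  rewrite (eq_card (B := pred1 i)) ?card1 // => j.
  by rewrite [LHS]unfold_in /= inE; case: eqP => [->|]; rewrite ?iJ ?andbF.
rewrite eq_card0 // => j; rewrite [LHS]unfold_in /=.
by apply/negP => /andP[jJ /eqP ji]; rewrite -ji jJ in iJ.
Qed.

Lemma mnm_weightE (c : {set 'I_n} -> nat) (m : 'X_{1..n.+1}) :
  ((\sum_J (ideal_mnm J *+ c J))%MM == m) =
  [forall i, colsum c i == xpart m i] && (\sum_J c J == m ord_max)%N.
Proof.
have wmax : (\sum_J (ideal_mnm J *+ c J))%MM ord_max = (\sum_J c J)%N.
  by rewrite mnm_sumE; apply: eq_bigr => J _; rewrite mulmnE ideal_mnm_max mul1n.
have wwid i : (\sum_J (ideal_mnm J *+ c J))%MM (widen_ord (leqnSn n) i)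
     = colsum c i.
  rewrite mnm_sumE /colsum [RHS]big_mkcond; apply: eq_bigr => J _.
  by rewrite mulmnE ideal_mnm_widen; case: ifP; rewrite ?mul1n.
apply/eqP/andP => [<-|[/forallP ci /eqP cm]].
  by rewrite wmax; split=> //; apply/forallP => i; rewrite -wwid.
apply/mnmP => i; have [j|] := unliftP ord_max i; last by move=> ->; rewrite wmax.
have -> : lift ord_max j = widen_ord (leqnSn n) j.
  by apply: val_inj; rewrite /= /bump leqNgt ltn_ord.
move=> ->; rewrite wwid; exact/eqP.
Qed.

(** At most one multiset contributes to [m]: the decomposition of [xpart m], whose total
    multiplicity must be the exponent of [t]. *)
Lemma ideals_sum_mcoeff D m : (mdeg m <= D)%N ->
  (ideals_sum (fun J => tvar n * xJ J) D)@_m = genF le m.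
Proof.
move=> mD; rewrite /ideals_sum raddf_sum /=.
under eq_bigr => c _.
  under eq_bigr do rewrite tvar_xJ mpolyXn.
  rewrite mprodXE mcoeffX mnm_weightE.
  over.
rewrite -natr_sum /genF natz -big_mkcondr sum1_card; congr Posz.
case: (boolP (_ && _)) => [/andP[wm /eqP num]|nm]; last first.
  rewrite eq_card0 // => c; rewrite [LHS]unfold_in /=; apply: contraNF nm.
  case/andP => /avoiding_laminarP lam /andP[/forallP cm /eqP sm].
  have eq_cx : colsum (fun J => c J) =1 xpart m by move=> i; apply/eqP.
  rewrite -(eq_weakPP _ eq_cx) -(eq_nu _ eq_cx) (colsum_weakPP leP) //.
  by rewrite (laminar_nu leP) // sm eqxx.
have lam := compmult_laminar leP wm.
(* Each multiplicity is at most [nu], which is the exponent of [t] in [m], so the cap [D] loses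
   nothing. *)
have bound J : (compmult le (xpart m) J < D.+1)%N.
  rewrite ltnS; apply: leq_trans mD; rewrite mdegE (bigD1 ord_max) //= -num.
  by rewrite -sum_compmult (bigD1 J) //= -addnA leq_addr.
pose c0 := [ffun J => Ordinal (bound J)].
rewrite (eq_card (B := pred1 c0)) ?card1 // => c; rewrite [LHS]unfold_in /= inE.
apply/andP/eqP => [[/avoiding_laminarP lc /andP[/forallP cm _]]|->].
  apply/ffunP => J; apply: val_inj; rewrite ffunE /=.
  apply: (laminar_inj leP lc lam) => i.
  by rewrite colsum_compmult //; apply/eqP.
have c0E : (fun J => c0 J : nat) =1 compmult le (xpart m).
  by move=> J; rewrite ffunE.
split.
  apply/avoiding_laminarP; case: lam => lJ lK.
  by split=> [J|J K]; rewrite !c0E; [apply: lJ|apply: lK].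
rewrite (eq_bigr _ (fun J _ => c0E J)) sum_compmult num eqxx andbT.
apply/forallP => i; rewrite /colsum (eq_bigr _ (fun J _ => c0E J)).
by rewrite -[X in _ == X](colsum_compmult wm).
Qed.

Lemma tx_identity (m : 'X_{1..n.+1}) :
  mulS (genF le) (fun m' => (DenTX le)@_m') m = (NumTX le)@_m.
Proof.
pose D := mdeg m; pose z J := tvar n * xJ J.
pose K (p : {mpoly int[n.+1]}) := forall m', (mdeg m' <= D)%N -> p@_m' = 0.
transitivity ((ideals_sum z D * DenTX le)@_m).
  rewrite /mulS (mcoeff_poly_mul_lin _ _ (ltnSn _)); apply: eq_bigr => k _.
  by rewrite ideals_sum_mcoeff // -ltnS bmdeg.
have -> : NumTX le = \prod_(Q in PiP le) (1 - \prod_(J in Q) z J).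
  apply: eq_bigr => Q; rewrite inE => /and3P[/eqP Q2 _ _].
  by rewrite big_split prodr_const Q2.
apply/eqP; rewrite -subr_eq0 -mcoeffB; apply/eqP.
have mulK a p : K p -> K (a * p).
  move=> Kp m' m'D; rewrite (mcoeff_poly_mul_lin_rev _ _ (ltnSn _)) big1 // => k _.
  by rewrite Kp ?mulr0 // (leq_trans _ m'D) // -ltnS bmdeg.
apply: (@avoiding_sum_cong _ K) => //.
- by move=> m' _; rewrite mcoeff0.
- by move=> p q Kp Kq m' m'D; rewrite mcoeffD Kp ?Kq ?addr0.
- exact: PiP_trivIset.
- exact: cover_PiP.
(* Each weight contains the factor [t], so its power [D.+1] has degree above [D]. *)
move=> J _ m' m'D; rewrite /z tvar_xJ mpolyXn mcoeffX.
case: eqP => // m'E; move: m'D; rewrite -m'E mdegMn mdegE (bigD1 ord_max) //=.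
by rewrite ideal_mnm_max mulnC mulnDr muln1 addSn ltnNge leq_addr.
Qed.

(** Column sums give a bijection from the multisets of total weight [d] onto the weak partitions of
    size [d]. *)
Lemma ideals_sum_coef D d : (d <= D)%N ->
  (ideals_sum (fun J => 'X^#|J| : {poly int}) D)`_d = (genQ le d)%:Z.
Proof.
move=> dD; rewrite /ideals_sum coef_sum.
under eq_bigr => c _.
  under eq_bigr do rewrite -exprM mulnC.
  rewrite prodrXr coefXn -sum_colsum eq_sym.
  over.
rewrite -natr_sum natz -big_mkcondr sum1dep_card; congr Posz.
(* [inord] takes its default value only when a column sum exceeds [d], which [hE] rules out for the
   multisets counted. *)
pose h (c : {ffun {set 'I_n} -> 'I_D.+1}) : {ffun 'I_n -> 'I_d.+1} :=
  [ffun i => inord (colsum (fun J => c J) i)].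
have hE (c : {ffun {set 'I_n} -> 'I_D.+1}) :
    (\sum_i colsum (fun J => c J : nat) i == d)%N ->
    forall i, h c i = colsum (fun J => c J) i :> nat.
  by move=> /eqP sc i; rewrite ffunE inordK // ltnS -sc (bigD1 i) //= leq_addr.
rewrite -(card_in_imset (f := h)); last first.
  move=> c c'; rewrite !inE => /andP[/avoiding_laminarP lc sc].
  case/andP=> /avoiding_laminarP lc' sc' hcc'.
  apply/ffunP => J; apply: val_inj; apply: (laminar_inj leP lc lc') => i.
  by rewrite -(hE c) // -(hE c') // hcc'.
congr #|pred_of_set _|; apply/setP => f; rewrite inE.
apply/imsetP/andP => [[c + ->]|[wf /eqP sf]].
  rewrite inE => /andP[/avoiding_laminarP lc sc].
  rewrite (eq_weakPP le (hE c sc)) (colsum_weakPP leP lc); split=> //.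
  by rewrite (eq_bigr _ (fun i _ => hE c sc i)).
pose g i := f i : nat.
have lam := compmult_laminar leP wf.
have cE := colsum_compmult wf.
(* A connected ideal is nonempty, so its multiplicity is at most its contribution to the total
   [d]. *)
have bound J : (compmult le g J < D.+1)%N.
  rewrite ltnS; apply: leq_trans dD; rewrite -sf.
  rewrite -(eq_bigr _ (fun i _ => cE i)) sum_colsum (bigD1 J) //=.
  apply: leq_trans (leq_addr _ _).
  have [->//|] := posnP (compmult le g J).
  move=> /[dup] gJ /(proj1 lam)/and3P[J0 _ _]; rewrite leq_pmulr // card_gt0.
  exact: J0.
pose c0 := [ffun J => Ordinal (bound J)].
have c0E : (fun J => c0 J : nat) =1 compmult le g by move=> J; rewrite ffunE.
have cc0 i : colsum (fun J => c0 J : nat) i = f i.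
  by rewrite -[RHS]cE; apply: eq_bigr => J _; rewrite c0E.
have sc0 : (\sum_i colsum (fun J => c0 J : nat) i == d)%N.
  by rewrite (eq_bigr _ (fun i _ => cc0 i)) sf.
exists c0; last by apply/ffunP => i; apply: val_inj; rewrite /= hE // cc0.
rewrite inE sc0 andbT; apply/avoiding_laminarP; case: lam => lJ lK.
by split=> [J|J K]; rewrite !c0E; [apply: lJ|apply: lK].
Qed.

Lemma q_identity (d : nat) :
  \sum_(i < d.+1) (genQ le i)%:Z * (DenQ le)`_(d - i) = (NumQ le)`_d.
Proof.
pose z (J : {set 'I_n}) : {poly int} := 'X^#|J|.
pose K (p : {poly int}) := forall i, (i <= d)%N -> p`_i = 0.
transitivity ((ideals_sum z d * DenQ le)`_d).
  rewrite coefM; apply: eq_bigr => i _.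
  by rewrite ideals_sum_coef // -ltnS.
have -> : NumQ le = \prod_(Q in PiP le) (1 - \prod_(J in Q) z J).
  by apply: eq_bigr => Q _; rewrite prodrXr.
apply/eqP; rewrite -subr_eq0 -coefB; apply/eqP.
have mulK a p : K p -> K (a * p).
  move=> Kp i id; rewrite coefM big1 // => j _.
  by rewrite Kp ?mulr0 // (leq_trans (leq_subr _ _)).
apply: (@avoiding_sum_cong _ K) => //.
- by move=> i _; rewrite coef0.
- by move=> p q Kp Kq i id; rewrite coefD Kp ?Kq ?addr0.
- exact: PiP_trivIset.
- exact: cover_PiP.
(* As [J] is nonempty, the power [d.+1] of its weight has degree above [d]. *)
move=> J; rewrite inE => /and3P[J0 _ _] i id; rewrite /z -exprM coefXn.
rewrite ltn_eqF // (leq_ltn_trans id) // (leq_trans (ltnSn d)) //.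
by rewrite leq_pmull // card_gt0.
Qed.

End Specialization.

Theorem theorem4p2 (n : nat) (le : rel 'I_n) (hP : forest_dup le) :
  (forall m : 'X_{1..n.+1},
      mulS (genF le) (fun m' => (DenTX le)@_m') m = (NumTX le)@_m)
  /\
  (forall d : nat,
      \sum_(i < d.+1) (genQ le i)%:Z * (DenQ le)`_(d - i) = (NumQ le)`_d).
Proof.
have [leP match_le] := forest_dup_matching hP.
by split=> [m|d]; [apply: tx_identity|apply: q_identity].
Qed.
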